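(* Let $\tau$ be a non-empty generalized pattern with no hyphens. Then for all $k\ge1$, $$\sum_{n\ge0}\sum_{\sigma\in[k]^n} y^{N_\tau(\sigma)}x^n=\frac{A_\tau(x;k)}{1-y\bigl((kx-1)A_\tau(x;k)+1\bigr)},$$ where $N_\tau(\sigma)$ is the maximum number of non-overlapping occurrences of $\tau$ in $\sigma$.
   Context: $[k]^n$ = words of length $n$ over $\{1,\dots,k\}$. A generalized pattern with no hyphens is a word $\tau=\tau_1\cdots\tau_m$ over $[\ell]$ using every letter of $[\ell]$. An occurrence of $\tau$ in $\sigma=\sigma_1\cdots\sigma_n$ is a factor $\sigma_i\cdots\sigma_{i+m-1}$ order-isomorphic to $\tau$ (i.e. $\sigma_{i+a-1}<\sigma_{i+b-1}$ iff $\tau_a<\tau_b$, and equality iff equality); two occurrences are non-overlapping if their sets of positions are disjoint. $\sigma$ avoids $\tau$ if it has no occurrence. $A_\tau(x;k)=\sum_{n\ge0}a_\tau(n;k)x^n$ with $a_\tau(n;k)$ the number of words in $[k]^n$ avoiding $\tau$ ($a_\tau(0;k)=1$). *)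

(* Defs.v *)
From HB Require Import structures.
From mathcomp Require Import all_boot all_order all_algebra.
From mathcomp Require Import boolp.

Set Implicit Arguments.
Unset Strict Implicit.
Unset Printing Implicit Defensive.

Import GRing.Theory.
Local Open Scope ring_scope.

(* The ring R[[x]] of formal power series with Cauchy product; a record,     *)
(* rather than an alias of nat -> R, so that no pointwise structure on       *)
(* functions can be picked up by unification.                                *)
Record fps (R : Type) := Fps { fps_coef :> nat -> R }.

Lemma fpsP (R : Type) (f g : fps R) : f =1 g <-> f = g.
Proof.
by case: f g => [f] [g]; split=> [/= /funext -> | [->]].
Qed.

HB.instance Definition _ (R : Type) := gen_eqMixin (fps R).
HB.instance Definition _ (R : Type) := gen_choiceMixin (fps R).

Section FpsZmodule.
Variable R : zmodType.
Implicit Types f g h : fps R.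

Definition fps_zero : fps R := Fps (fun=> 0).
Definition fps_opp f : fps R := Fps (fun n => - f n).
Definition fps_add f g : fps R := Fps (fun n => f n + g n).

Fact fps_addA : associative fps_add.
Proof. by move=> f g h; apply/fpsP => n /=; rewrite addrA. Qed.
Fact fps_addC : commutative fps_add.
Proof. by move=> f g; apply/fpsP => n /=; rewrite addrC. Qed.
Fact fps_add0 : left_id fps_zero fps_add.
Proof. by move=> f; apply/fpsP => n /=; rewrite add0r. Qed.
Fact fps_addN : left_inverse fps_zero fps_opp fps_add.
Proof. by move=> f; apply/fpsP => n /=; rewrite addNr. Qed.

HB.instance Definition _ :=
  GRing.isZmodule.Build (fps R) fps_addA fps_addC fps_add0 fps_addN.
End FpsZmodule.

Section FpsRing.
Variable R : comNzRingType.
Implicit Types f g h : fps R.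

Definition fps_one : fps R := Fps (fun n => (n == 0%N)%:R).
Definition fps_mul f g : fps R :=
  Fps (fun n => \sum_(i < n.+1) f i * g (n - i)%N).

Let trunc N f : {poly R} := \poly_(i < N.+1) f i.

Let fps_mulE N f g n : (n <= N)%N ->
  fps_mul f g n = (trunc N f * trunc N g)`_n.
Proof.
move=> le_nN; rewrite coefM /=; apply: eq_bigr => i _.
have le_in: (i <= n)%N by rewrite -ltnS.
by rewrite !coef_poly !ltnS (leq_trans le_in) // (leq_trans (leq_subr _ _)).
Qed.

Fact fps_mulC : commutative fps_mul.
Proof. by move=> f g; apply/fpsP => n; rewrite !(@fps_mulE n) // mulrC. Qed.

Fact fps_mulA : associative fps_mul.
Proof.
move=> f g h; apply/fpsP => n.
transitivity (trunc n f * trunc n g * trunc n h)`_n.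
  rewrite -mulrA coefM; apply: eq_bigr => i _.
  by rewrite coef_poly ltn_ord (@fps_mulE n) // leq_subr.
rewrite coefM; apply/esym/eq_bigr => i _.
by rewrite (@fps_mulE n) -1?ltnS ?ltn_ord // coef_poly ltnS leq_subr.
Qed.

Fact fps_mul1 : left_id fps_one fps_mul.
Proof.
move=> f; apply/fpsP => n /=.
by rewrite big_ord_recl big1 /= ?mul1r ?subn0 ?addr0 // => i _; rewrite mul0r.
Qed.

Fact fps_mulDl : left_distributive fps_mul (@fps_add R).
Proof.
move=> f g h; apply/fpsP => n /=; rewrite -big_split.
by apply: eq_bigr => i _; rewrite mulrDl.
Qed.

Fact fps_one_neq0 : fps_one != 0.
Proof.
by apply/eqP => /fpsP/(_ 0%N) /eqP; rewrite /= oner_eq0.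
Qed.

HB.instance Definition _ := GRing.Zmodule_isComNzRing.Build (fps R)
  fps_mulA fps_mulC fps_mul1 fps_mulDl fps_one_neq0.

Definition fpsC (c : R) : fps R := Fps (fun n => if n == 0%N then c else 0).
Definition fpsX : fps R := Fps (fun n => (n == 1%N)%:R).

Lemma coef_fps0 n : (0 : fps R) n = 0. Proof. by []. Qed.
Lemma coef_fps1 n : (1 : fps R) n = (n == 0%N)%:R. Proof. by []. Qed.
Lemma coef_fpsD f g n : (f + g) n = f n + g n. Proof. by []. Qed.
Lemma coef_fpsN f n : (- f) n = - f n. Proof. by []. Qed.
Lemma coef_fpsM f g n : (f * g) n = \sum_(i < n.+1) f i * g (n - i)%N.
Proof. by []. Qed.
Lemma coef_fpsM0 f g : (f * g) 0%N = f 0%N * g 0%N.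
Proof. by rewrite coef_fpsM big_ord1. Qed.
End FpsRing.

Arguments fpsX {R}.

Section FpsUnit.
Variable R : comUnitRingType.
Implicit Types f g : fps R.

(* The first n.+1 coefficients of 1 / f, from                                *)
(* g_0 = 1 / f_0 and g_n = - (1 / f_0) * sum_(i < n) f_(n - i) g_i.          *)
Fixpoint fps_inv_seq f n : seq R :=
  if n is n'.+1 then
    let s := fps_inv_seq f n' in
    rcons s (- (f 0%N)^-1 * \sum_(i < n) f (n - i)%N * s`_i)
  else [:: (f 0%N)^-1].

Definition fps_unit : {pred fps R} := fun f => f 0%N \is a GRing.unit.

(* As everywhere in the library, the inverse of a non-unit is itself.        *)
Definition fps_inv f : fps R :=
  if f \in fps_unit then Fps (fun n => (fps_inv_seq f n)`_n) else f.

Let size_inv f n : size (fps_inv_seq f n) = n.+1.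
Proof. by elim: n => //= n IHn; rewrite size_rcons IHn. Qed.

Let nth_inv f n i : (i <= n)%N -> (fps_inv_seq f n)`_i = (fps_inv_seq f i)`_i.
Proof.
elim: n => [|n IHn]; first by case: i.
rewrite leq_eqVlt ltnS => /predU1P[-> //|le_in].
by rewrite /= nth_rcons size_inv ltnS le_in IHn.
Qed.

Fact fps_mulV : {in fps_unit, left_inverse 1 fps_inv *%R}.
Proof.
move=> f Uf; apply/fpsP => n; rewrite mulrC coef_fpsM /fps_inv Uf /=.
rewrite (reindex_inj rev_ord_inj) /=.
case: n => [|n]; first by rewrite big_ord1 divrr.
rewrite big_ord_recr /= !subSS !subnn subn0 nth_rcons size_inv ltnn eqxx.
rewrite mulrA mulrN divrr // mulN1r.
apply/eqP; rewrite subr_eq0; apply/eqP/eq_bigr => i _.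
have le_in: (i <= n)%N by rewrite -ltnS.
by rewrite !subSS subKn ?nth_inv // 1?leqW.
Qed.

Fact fps_unitP f g : g * f = 1 -> f \in fps_unit.
Proof.
move=> /fpsP/(_ 0%N); rewrite coef_fpsM0 coef_fps1 /= => gf1.
by apply/unitrPr; exists (g 0%N); rewrite mulrC.
Qed.

Fact fps_inv_out : {in [predC fps_unit], fps_inv =1 id}.
Proof. by move=> f; rewrite inE /= /fps_inv => /negbTE->. Qed.

HB.instance Definition _ := GRing.ComNzRing_hasMulInverse.Build (fps R)
  fps_mulV fps_unitP fps_inv_out.

Lemma fps_unitE f : (f \is a GRing.unit) = (f 0%N \is a GRing.unit).
Proof. by []. Qed.
End FpsUnit.

(* A word over [k] is a tuple over 'I_k: the letters are 0, ..., k - 1       *)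
(* instead of 1, ..., k, and positions also start at 0.                      *)
Section Patterns.
Local Open Scope nat_scope.

Definition order_isomorphic (u v : seq nat) : bool :=
  (size u == size v) &&
  [forall a : 'I_(size u), forall b : 'I_(size u),
    ((nth 0 u a < nth 0 u b) == (nth 0 v a < nth 0 v b)) &&
    ((nth 0 u a == nth 0 u b) == (nth 0 v a == nth 0 v b))].

Variables (l m : nat) (tau : m.-tuple 'I_l).

Definition is_pattern : bool := [forall a : 'I_l, a \in tau].

Variables (k n : nat) (sigma : n.-tuple 'I_k).

(* The size test in order_isomorphic forces i + m <= n when 0 < m.           *)
Definition occurs_at (i : 'I_n) : bool :=
  order_isomorphic (take m (drop i (map val sigma))) (map val tau).

Definition avoids : bool := ~~ [exists i : 'I_n, occurs_at i].

Definition occ_positions (i : 'I_n) : {set 'I_n} :=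
  [set j : 'I_n | i <= j < i + m].

Definition nonoverlapping_occs (S : {set 'I_n}) : bool :=
  [forall i in S, occurs_at i] &&
  [forall i in S, forall j in S,
    (i != j) ==> [disjoint occ_positions i & occ_positions j]].

Definition max_nonoverlapping : nat :=
  \max_(S : {set 'I_n} | nonoverlapping_occs S) #|S|.

End Patterns.

Definition avoid_count (l m : nat) (tau : m.-tuple 'I_l) (k n : nat) : nat :=
  #|[set sigma : n.-tuple 'I_k | avoids tau sigma]|.

(* Series in x with coefficients in Z[y]; y is the variable of {poly int}.   *)
Definition fps_x : fps {poly int} := fpsX.
Definition fps_y : fps {poly int} := fpsC 'X.

Definition avoid_gf (l m : nat) (tau : m.-tuple 'I_l) (k : nat) :
  fps {poly int} := Fps (fun n => (avoid_count tau k n)%:R).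

Definition nonoverlap_gf (l m : nat) (tau : m.-tuple 'I_l) (k : nat) :
  fps {poly int} :=
  Fps (fun n => \sum_(sigma : n.-tuple 'I_k) 'X ^+ max_nonoverlapping tau sigma).

Lemma avoid_count0 (l m : nat) (tau : m.-tuple 'I_l) (k : nat) :
  avoid_count tau k 0 = 1%N.
Proof.
rewrite /avoid_count (_ : [set _ | _] = setT) ?cardsT ?card_tuple //.
by apply/setP => s; rewrite !inE; apply/existsP => -[[]].
Qed.

(* The denominator has constant term 1, so the quotient is a genuine one.    *)
Lemma nonoverlap_denom_unit (l m : nat) (tau : m.-tuple 'I_l) (k : nat) :
  1 - fps_y * ((k%:R * fps_x - 1) * avoid_gf tau k + 1) \is a GRing.unit.
Proof.
rewrite fps_unitE !(coef_fpsM0, coef_fpsD, coef_fpsN, coef_fps1) /=.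
by rewrite avoid_count0 mulr0 sub0r mulr1 addNr mulr0 subr0 unitr1.
Qed.

(* Main.v *)
Require Import Defs.
From mathcomp Require Import all_boot all_order all_algebra.
From mathcomp Require Import zify.

Set Implicit Arguments.
Unset Strict Implicit.
Unset Printing Implicit Defensive.

Import GRing.Theory.
Local Open Scope ring_scope.

(** If a word contains [tau], cut it after its shortest prefix containing
    [tau]. An occurrence in the whole word cannot end inside a proper prefix of
    that shortest prefix, so all members of a non-overlapping family but the
    leftmost lie in the remaining suffix; the maximum is thus one plus the
    maximum of the suffix. With [A] the series of the avoiding words, the
    shortest prefixes are the one-letter extensions of avoiding words that do
    not avoid, hence have series [B = (k x - 1) A + 1], and the series [F] of
    the theorem satisfies [F = A + y B F]. *)

(** Cutting a word into prefix and suffix is a bijection; with [F] defined on [seq T], the summand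
    needs no cast between tuple lengths. *)
Lemma big_cat_tuple (R : nmodType) (T : finType) (p q : nat) (F : seq T -> R) :
  \sum_(s : (p + q).-tuple T) F s =
  \sum_(u : p.-tuple T) \sum_(v : q.-tuple T) F (u ++ v).
Proof.
rewrite pair_big /=.
rewrite (reindex (fun uv : p.-tuple T * q.-tuple T => cat_tuple uv.1 uv.2)) //=.
have sz_take (s : (p + q).-tuple T) : size (take p s) == p.
  by rewrite size_takel // size_tuple leq_addr.
have sz_drop (s : (p + q).-tuple T) : size (drop p s) == q.
  by rewrite size_drop size_tuple addKn.
exists (fun s => (Tuple (sz_take s), Tuple (sz_drop s))) => [[u v] _|s _].
  by congr (_, _); apply: val_inj => /=;
     rewrite ?take_size_cat ?drop_size_cat ?size_tuple.
by apply: val_inj; rewrite /= cat_take_drop.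
Qed.

(** * Occurrences, shortest prefixes and packings on plain sequences *)

Section Occurrences.
Local Open Scope nat_scope.

Variables (T : Type) (m : nat) (P : pred (seq T)).

Implicit Types (u v w : seq T) (s : seq nat).

Definition occurrence w i := P (take m (drop i w)).
Definition contains w := has (occurrence w) (iota 0 (size w)).
(** Testing the prefix one letter shorter suffices, since containment passes to longer prefixes. *)
Definition minimal_containing w :=
  contains w && ~~ contains (take (size w).-1 w).
(** The gap relation is not symmetric, so starts are listed from left to right and the head is the
    leftmost occurrence. *)
Definition packing w s :=
  all (occurrence w) s && pairwise (fun i j => i + m <= j) s.

Lemma contains_nil : contains [::] = false. Proof. by []. Qed.

Lemma minimal_prefix_exists w : contains w ->
  exists2 i, i <= size w & minimal_containing (take i w).
Proof.
move=> cw; have ex : exists i, contains (take i w).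
  by exists (size w); rewrite take_size.
case: (ex_minnP ex) => i ci min_i.
have i_le : i <= size w by apply: min_i; rewrite take_size.
exists i => //; apply/andP; split => //; apply/negP.
rewrite size_takel // take_takel ?leq_pred // => /min_i.
(* Either the prefix is empty and contains nothing, or [i] would be at most its predecessor. *)
by case: i ci {min_i i_le} => [|i] //=; [rewrite take0 | lia].
Qed.

Hypothesis size_P : forall w, P w -> size w = m.
Hypothesis m_gt0 : 0 < m.

Lemma occurrence_size w i : occurrence w i -> i + m <= size w.
Proof. by move/size_P; rewrite size_take size_drop; case: ifP; lia. Qed.

Lemma occurrence_catl u v i :
  i + m <= size u -> occurrence (u ++ v) i = occurrence u i.
Proof.
move=> le_u; rewrite /occurrence drop_cat ifT; last by lia.
by rewrite takel_cat // size_drop; lia.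
Qed.

Lemma occurrence_catr u v i : occurrence (u ++ v) (size u + i) = occurrence v i.
Proof. by rewrite /occurrence drop_cat ltnNge leq_addr /= addKn. Qed.

Lemma containsP w : reflect (exists i, occurrence w i) (contains w).
Proof.
apply: (iffP hasP) => [[i _ oi]|[i oi]]; exists i => //.
by rewrite mem_iota; move/occurrence_size: oi; lia.
Qed.

Lemma contains_catl u v : contains u -> contains (u ++ v).
Proof.
move=> /containsP[i oi]; apply/containsP; exists i.
by rewrite occurrence_catl // occurrence_size.
Qed.

Lemma contains_take w i j : i <= j -> contains (take i w) -> contains (take j w).
Proof.
by move=> le_ij; rewrite -(cat_take_drop i (take j w)) take_takel //;
  exact: contains_catl.
Qed.

(** An occurrence in [u] ends within [u], so it can precede a packing of [v] shifted past [u]. *)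
Lemma packing_cat_ge u v s : contains u -> packing v s ->
  exists i, packing (u ++ v) (i :: map (addn (size u)) s).
Proof.
move=> /containsP[i oi] /andP[/allP s_occ s_gap].
have le_iu := occurrence_size oi; exists i.
rewrite /packing /= occurrence_catl // oi /= pairwise_map.
apply/and3P; split.
- by apply/allP => _ /mapP[j /s_occ oj ->]; rewrite occurrence_catr.
- by apply/allP => _ /mapP[j _ ->]; lia.
- by apply: sub_pairwise s_gap => a b /=; lia.
Qed.

(** By minimality the head cannot end before [u] does; all later members therefore start in [v]. *)
Lemma packing_cat_le u v i s :
  minimal_containing u -> packing (u ++ v) (i :: s) ->
  packing v (map (subn^~ (size u)) s).
Proof.
move=> /andP[_ min_u] /andP[/= /andP[oi s_occ] /andP[i_s s_gap]].
have ge_u : size u <= i + m.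
  rewrite leqNgt; apply: contra min_u => lt_u; apply/containsP; exists i.
  rewrite -(occurrence_catl (drop (size u).-1 u)) ?cat_take_drop.
    by rewrite -(occurrence_catl v) // ltnW.
  by rewrite size_take; case: ifP; lia.
have s_ge j : j \in s -> size u <= j by move=> /(allP i_s); lia.
apply/andP; split.
  apply/allP => _ /mapP[j js ->].
  by rewrite -(occurrence_catr u) subnKC ?s_ge // (allP s_occ).
rewrite pairwise_map.
apply: (sub_in_pairwise (P := [in s])) s_gap; last by apply/allP.
by move=> a b /s_ge a_ge /s_ge b_ge /=; lia.
Qed.

(** Without its last letter, the longer prefix would still include the shorter one, against
    minimality. *)
Lemma minimal_prefix_unique w i j : i <= size w -> j <= size w ->
  minimal_containing (take i w) -> minimal_containing (take j w) -> i = j.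
Proof.
have no_lt a b : b <= size w -> a < b ->
    contains (take a w) -> ~~ minimal_containing (take b w).
  move=> b_le lt_ab c_a; rewrite negb_and negbK size_takel //.
  rewrite take_takel ?leq_pred //; apply/orP; right.
  by apply: contains_take c_a; lia.
move=> i_le j_le mi mj; case: (ltngtP i j) => // lt.
  by move: (no_lt _ _ j_le lt (proj1 (andP mi))); rewrite mj.
by move: (no_lt _ _ i_le lt (proj1 (andP mj))); rewrite mi.
Qed.

End Occurrences.

(** * The pattern in words over ['I_k], and maxima as sizes of packings *)

Section Series.
Variables (l m : nat) (tau : m.-tuple 'I_l) (k : nat).
Hypothesis m_gt0 : (0 < m)%N.

Local Notation word := (seq 'I_k).

Definition pattern_match (w : word) : bool :=
  order_isomorphic (map val w) (map val tau).

Lemma size_pattern_match w : pattern_match w -> size w = m.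
Proof. by case/andP => /eqP; rewrite !size_map size_tuple. Qed.

Local Notation occ := (occurrence m pattern_match).
Local Notation cont := (contains m pattern_match).
Local Notation minc := (minimal_containing m pattern_match).
Local Notation pack := (packing m pattern_match).

Lemma occurs_atE n (s : n.-tuple 'I_k) i : occurs_at tau s i = occ s i.
Proof. by rewrite /occurs_at -map_drop -map_take. Qed.

Lemma avoidsE n (s : n.-tuple 'I_k) : avoids tau s = ~~ cont s.
Proof.
congr negb; apply/existsP/(containsP size_pattern_match m_gt0) => -[i oi].
  by exists i; rewrite -occurs_atE.
have lt_in : (i < n)%N.
  have := occurrence_size size_pattern_match m_gt0 oi.
  by rewrite size_tuple; lia.
by exists (Ordinal lt_in); rewrite occurs_atE.
Qed.

Lemma packing_le_max n (s : n.-tuple 'I_k) (p : seq nat) :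
  pack s p -> (size p <= max_nonoverlapping tau s)%N.
Proof.
case/andP => p_occ p_gap.
have lt_p i : i \in p -> (i < n)%N.
  move=> /(allP p_occ)/(occurrence_size size_pattern_match m_gt0).
  by rewrite size_tuple; lia.
have p_sorted : sorted ltn p.
  by apply/pairwise_sorted; apply: sub_pairwise p_gap => a b /=; lia.
have p_uniq : uniq p := sorted_uniq ltn_trans ltnn p_sorted.
pose S : {set 'I_n} := [set i : 'I_n | val i \in p].
have -> : size p = #|S|.
  rewrite cardE -(size_map val); apply/perm_size/uniq_perm => //.
    by rewrite map_inj_uniq ?enum_uniq //; exact: val_inj.
  move=> i; apply/idP/mapP => [ip|[j]]; last by rewrite mem_enum inE => ? ->.
  by exists (Ordinal (lt_p i ip)) => //; rewrite mem_enum inE.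
apply: (leq_bigmax_cond (F := fun S : {set 'I_n} => #|S|)).
apply/andP; split.
  by apply/'forall_implyP => i; rewrite inE occurs_atE => /(allP p_occ).
(* [p_gap] compares list indices; sortedness of [p] turns an order of values into one of indices. *)
have gap (i j : nat) : i \in p -> j \in p -> (i < j)%N -> (i + m <= j)%N.
  move=> ip jp lt_ij.
  have lt_idx : (index i p < index j p)%N.
    rewrite ltnNge; apply/negP => le_idx.
    have := sorted_leq_nth leq_trans leqnn 0%N
      (sub_sorted (fun a b => @ltnW a b) p_sorted).
    move/(_ (index j p) (index i p)); rewrite !inE !index_mem !nth_index //.
    by move=> /(_ jp ip le_idx); lia.
  move/(pairwiseP 0%N): p_gap => /(_ (index i p) (index j p)).
  by rewrite !inE !index_mem !nth_index //; apply.
apply/'forall_implyP => i; rewrite inE => ip.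
apply/'forall_implyP => j; rewrite inE => jp; apply/implyP => neq_ij.
rewrite disjoint_subset; apply/subsetP => x; rewrite !inE.
have /orP[] : (val i < val j)%N || (val j < val i)%N by rewrite -neq_ltn.
  by move=> /(gap _ _ ip jp) /=; lia.
by move=> /(gap _ _ jp ip) /=; lia.
Qed.

(** Listing a largest admissible set in increasing order gives the packing. *)
Lemma max_packing n (s : n.-tuple 'I_k) :
  exists2 p, pack s p & size p = max_nonoverlapping tau s.
Proof.
have S0 : nonoverlapping_occs tau s set0.
  by apply/andP; split; apply/'forall_implyP => i; rewrite inE.
have [|S S_ok eqS] :=
    @eq_bigmax_cond _ (nonoverlapping_occs tau s) (fun S => #|S|).
  by apply/card_gt0P; exists set0.
have /andP[/'forall_implyP S_occ /'forall_implyP S_dis] := S_ok.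
exists (map val (enum S)); last by rewrite size_map -cardE -eqS.
apply/andP; split.
  by apply/allP => x /mapP[i]; rewrite mem_enum => /S_occ oi ->;
    rewrite -occurs_atE.
have sorted_S : pairwise (relpre val ltn) (enum S).
  rewrite -pairwise_map -sorted_pairwise; last exact: ltn_trans.
  rewrite sorted_map /enum_mem; apply: sorted_filter.
    by move=> a b c; apply: ltn_trans.
  by rewrite -sorted_map -enumT val_enum_ord iota_ltn_sorted.
rewrite pairwise_map.
apply: (sub_in_pairwise (P := [in S])) sorted_S; last first.
  by apply/allP => i; rewrite mem_enum.
(* If [j < i + m], position [j] is covered by both occurrences, which are disjoint. *)
move=> i j iS jS /= lt_ij; rewrite leqNgt; apply/negP => lt_j.
have neq_ij : i != j by rewrite neq_ltn lt_ij.
have /'forall_implyP/(_ j jS)/implyP/(_ neq_ij) := S_dis i iS.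
move/disjointFr => /(_ j); rewrite !inE.
by move/(_ ltac:(by lia)); lia.
Qed.

Definition maxocc (w : word) : nat := max_nonoverlapping tau (in_tuple w).

(** [s] and [in_tuple s] differ in their length index; packings see only the underlying sequence, so
    each maximum bounds the other. *)
Lemma maxoccE n (s : n.-tuple 'I_k) : max_nonoverlapping tau s = maxocc s.
Proof.
apply/eqP; rewrite /maxocc eqn_leq; apply/andP; split.
  by have [p ps <-] := max_packing s; apply: packing_le_max.
by have [p ps <-] := max_packing (in_tuple s); apply: packing_le_max.
Qed.

Lemma maxocc_cat (u v : word) : minc u -> maxocc (u ++ v) = (maxocc v).+1.
Proof.
move=> min_u; apply/eqP; rewrite eqn_leq; apply/andP; split.
  have [[|i p] ps eq_p] := max_packing (in_tuple (u ++ v)).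
    by rewrite /maxocc -eq_p.
  rewrite /maxocc -eq_p /= ltnS -(size_map (subn^~ (size u))).
  apply: packing_le_max.
  exact: (packing_cat_le size_pattern_match m_gt0 min_u ps).
have [p ps eq_p] := max_packing (in_tuple v); rewrite /maxocc -eq_p.
have [i ips] :=
  packing_cat_ge size_pattern_match m_gt0 (proj1 (andP min_u)) ps.
by have := packing_le_max (s := in_tuple (u ++ v)) ips; rewrite /= size_map.
Qed.

Lemma maxocc_avoiding (w : word) : ~~ cont w -> maxocc w = 0%N.
Proof.
move=> /negP no_occ; have [[|i p] ps eq_p] := max_packing (in_tuple w).
  by rewrite /maxocc -eq_p.
case: no_occ; apply/(containsP size_pattern_match m_gt0); exists i.
by case/andP: ps => /andP[].
Qed.

(** * Generating functions *)

Definition minimal_gf : fps {poly int} :=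
  Fps (fun n => \sum_(s : n.-tuple 'I_k | minc s) 1).

Lemma avoid_gfE n :
  avoid_gf tau k n = \sum_(s : n.-tuple 'I_k | ~~ cont s) 1.
Proof.
rewrite /= /avoid_count -sum1_card natr_sum; apply: eq_bigl => s.
by rewrite inE avoidsE.
Qed.

Lemma coef_natXM (f : fps {poly int}) n :
  (k%:R * fps_x * f) n = if n is n'.+1 then k%:R * f n' else 0.
Proof.
have coef_kM (g : fps {poly int}) i : (k%:R * g) i = k%:R * g i.
  by rewrite !mulr_natl; elim: k => // j IHj; rewrite !mulrS coef_fpsD IHj.
rewrite -mulrA coef_kM coef_fpsM; case: n => [|n].
  by rewrite big_ord1 mul0r mulr0.
rewrite big_ord_recl mul0r add0r big_ord_recl mul1r big1 ?addr0.
  by rewrite /= subSS subn0.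
by move=> i _; rewrite mul0r.
Qed.

(** Extending avoiding words of length [n] by one of [k] letters gives each word that avoids or
    minimally contains the pattern, exactly once. *)
Lemma minimal_gfE :
  minimal_gf = (k%:R * fps_x - 1) * avoid_gf tau k + 1.
Proof.
apply/fpsP => n; rewrite mulrBl mul1r !coef_fpsD coef_fpsN coef_natXM.
case: n => [|n].
  (* In degree 0 both sides vanish, as the empty word avoids the pattern. *)
  rewrite /= avoid_count0 add0r addNr big1 // => s.
  by rewrite tuple0 /minimal_containing contains_nil.
rewrite addr0; apply/eqP; rewrite eq_sym subr_eq; apply/eqP.
rewrite !avoid_gfE /=.
transitivity (\sum_(s : (n + 1).-tuple 'I_k) (~~ cont (take n s))%:R : {poly int}).
  rewrite (big_cat_tuple _ _ (fun w => (~~ cont (take n w))%:R)) mulr_sumr.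
  rewrite big_mkcond; apply: eq_bigr => u _.
  under eq_bigr do rewrite take_size_cat ?size_tuple //.
  rewrite sumr_const card_tuple card_ord expn1.
  by case: (cont u); rewrite /= ?mul0rn ?mulr1.
rewrite addn1 [in RHS]big_mkcond [X in _ + X]big_mkcond -big_split /=.
apply: eq_bigr => s _; rewrite /minimal_containing size_tuple /=.
(* If the prefix contains the pattern, so does [s], and both terms vanish. *)
have := contains_catl size_pattern_match m_gt0 (u := take n s) (drop n s).
rewrite cat_take_drop.
by case: (cont (take n s)) => [-> //|_]; case: (cont s); rewrite /= ?addr0 ?add0r.
Qed.

Lemma nonoverlap_gf_rec :
  nonoverlap_gf tau k =
  avoid_gf tau k + fps_y * (minimal_gf * nonoverlap_gf tau k).
Proof.
apply/fpsP => n; rewrite coef_fpsD avoid_gfE.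
have coef_yM (f : fps {poly int}) : (fps_y * f) n = 'X * f n.
  rewrite coef_fpsM big_ord_recl big1 ?addr0 ?subn0 // => i _.
  by rewrite mul0r.
rewrite coef_yM coef_fpsM mulr_sumr /=.
rewrite (bigID (fun s : n.-tuple 'I_k => ~~ cont s)) /=; congr (_ + _).
  by apply: eq_bigr => s no_s; rewrite maxoccE maxocc_avoiding.
(* [G] records the cut length [i], which becomes the index of the Cauchy product. *)
pose G (i : nat) (w : word) : {poly int} :=
  if minc (take i w) then 'X ^+ maxocc w else 0.
(* Exactly one [i] contributes for a containing word, none for an avoiding one. *)
transitivity (\sum_(s : n.-tuple 'I_k) \sum_(i < n.+1) G i s).
  rewrite big_mkcond; apply: eq_bigr => s _; rewrite negbK maxoccE.
  case: ifP => cs; last first.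
    rewrite big1 // => i _; rewrite /G; case: ifP => // /andP[ci _].
    have := contains_catl size_pattern_match m_gt0 (drop i s) ci.
    by rewrite cat_take_drop cs.
  have [i i_le mi] := minimal_prefix_exists cs.
  have lt_i : (i < n.+1)%N by rewrite ltnS -(size_tuple s).
  rewrite (bigD1 (Ordinal lt_i)) //= /G mi big1 ?addr0 // => j neq_j.
  case: ifP => // mj; case/eqP: neq_j; apply: val_inj => /=.
  apply: (minimal_prefix_unique size_pattern_match m_gt0 _ i_le mj mi).
  by rewrite size_tuple -ltnS.
rewrite exchange_big; apply: eq_bigr => i _ /=.
have le_in : (i <= n)%N by rewrite -ltnS.
transitivity (\sum_(s : (i + (n - i)).-tuple 'I_k) G i s).
  by rewrite subnKC.
rewrite (big_cat_tuple _ _ (G i)) mulr_suml mulr_sumr [RHS]big_mkcond.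
apply: eq_bigr => u _; rewrite mul1r mulr_sumr.
case: ifP => mu; last first.
  by rewrite big1 // => v _; rewrite /G take_size_cat ?size_tuple ?mu.
apply: eq_bigr => v _.
by rewrite /G take_size_cat ?size_tuple // mu maxocc_cat // exprS maxoccE.
Qed.

End Series.

Theorem mainTheorem13 (l m : nat) (tau : m.-tuple 'I_l)
    (tau_nonempty : (0 < m)%N) (tau_pattern : is_pattern tau)
    (k : nat) (k_ge1 : (1 <= k)%N) :
  nonoverlap_gf tau k =
    avoid_gf tau k
      / (1 - fps_y * ((k%:R * fps_x - 1) * avoid_gf tau k + 1)).
Proof.
apply: (canRL (mulrK (nonoverlap_denom_unit tau k))).
rewrite -(minimal_gfE tau k tau_nonempty) mulrBr mulr1.
(* Only the first copy of the series is expanded; the other cancels the product term of the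
   recursion. *)
rewrite {1}(nonoverlap_gf_rec tau k tau_nonempty).
by rewrite [X in _ - X]mulrC -mulrA addrK.
Qed.
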